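(* Let $A\in\mathbb{R}^{n\times n}$, $B\in\mathbb{R}^{n\times m}$ with $(A,B)$ controllable, let $\alpha>0$ and let $P\in\mathbb{R}^{n\times n}$ be symmetric positive definite with $PA+A^TP-2PBB^TP+2\alpha P<0$. Let $\mathcal{G}$ be an undirected connected graph on $N$ nodes with Laplacian $\mathcal{L}$ whose second smallest eigenvalue is $\lambda_2>0$. Set $F=-B^TP$, choose $c\geq 1/\lambda_2$, and define $\hat{\mathcal{L}}=\mathcal{L}\otimes P$, $\bar A=I_N\otimes A$, $\bar B=c\,\mathcal{L}\otimes BF$, $A_c=\bar A+\bar B$. Then the symmetric matrix $\bar{\mathcal{L}}=\hat{\mathcal{L}}A_c+A_c^T\hat{\mathcal{L}}$ has exactly $n$ eigenvalues equal to zero and all its other eigenvalues are negative. Moreover, the eigenvectors of $\bar{\mathcal{L}}$ associated with its zero eigenvalues belong to the subspace spanned by the eigenvectors of $\hat{\mathcal{L}}$ associated with its $n$ zero eigenvalues (i.e. vectors of the form $\mathbf{1}_N\otimes\varsigma$, $\varsigma\in\mathbb{R}^n$).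
   Context: $\mathcal{L}=\mathcal{D}-\mathcal{A}$ is the Laplacian of the graph ($\mathcal{A}$ the 0/1 adjacency matrix, $\mathcal{D}$ the diagonal degree matrix); for a connected undirected graph its eigenvalues are $0=\lambda_1<\lambda_2\le\dots\le\lambda_N$. $\otimes$ is the Kronecker product, $I_N$ the $N\times N$ identity, $\mathbf{1}_N$ the all-ones vector. *)

(* Defs.v *)
From HB Require Import structures.
From mathcomp Require Import all_boot all_order all_algebra.
Set Implicit Arguments. Unset Strict Implicit. Unset Printing Implicit Defensive.
Import Order.TTheory GRing.Theory Num.Theory.
Local Open Scope ring_scope.

Lemma kron_idx_div m1 m2 (k : 'I_(m1 * m2)) : (k %/ m2 < m1)%N.
Proof.
case: m2 k => [|m2] k; first by case: k => /= x; rewrite muln0.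
by rewrite ltn_divLR // ltn_ord.
Qed.

Lemma kron_idx_mod m1 m2 (k : 'I_(m1 * m2)) : (k %% m2 < m2)%N.
Proof.
case: m2 k => [|m2] k; first by case: k => /= x; rewrite muln0.
by rewrite ltn_pmod.
Qed.

Definition kidx1 m1 m2 (k : 'I_(m1 * m2)) : 'I_m1 := Ordinal (kron_idx_div k).
Definition kidx2 m1 m2 (k : 'I_(m1 * m2)) : 'I_m2 := Ordinal (kron_idx_mod k).

(* Kronecker product A (x) B, with (A (x) B)[(i1,i2),(j1,j2)] = A i1 j1 * B i2 j2,
   the pair (i1,i2) being encoded as i1 * m2 + i2. *)
Definition kron (R : pzRingType) m1 n1 m2 n2 (A : 'M[R]_(m1, n1)) (B : 'M[R]_(m2, n2))
  : 'M[R]_(m1 * m2, n1 * n2) :=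
  \matrix_(i, j) (A (kidx1 i) (kidx1 j) * B (kidx2 i) (kidx2 j)).

Definition simple_graph N (e : rel 'I_N) := symmetric e /\ irreflexive e.
Definition connected_graph N (e : rel 'I_N) := forall i j : 'I_N, connect e i j.

Definition adjacency (R : pzRingType) N (e : rel 'I_N) : 'M[R]_N :=
  \matrix_(i, j) (if e i j then 1 else 0).
Definition degree_mx (R : pzRingType) N (e : rel 'I_N) : 'M[R]_N :=
  \matrix_(i, j) (if i == j then \sum_(k < N) adjacency R e i k else 0).
Definition laplacian (R : pzRingType) N (e : rel 'I_N) : 'M[R]_N :=
  degree_mx R e - adjacency R e.

Definition posdef (R : numDomainType) n (M : 'M[R]_n) :=
  M^T = M /\ forall x : 'cV[R]_n, x != 0 -> 0 < (x^T *m M *m x) 0 0.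
Definition negdef (R : numDomainType) n (M : 'M[R]_n) :=
  M^T = M /\ forall x : 'cV[R]_n, x != 0 -> (x^T *m M *m x) 0 0 < 0.

(* Kalman controllability: the columns of [B, AB, ..., A^(n-1) B] span R^n,
   i.e. the row space of the transposed controllability matrix is full. *)
Definition controllable (R : fieldType) n m (A : 'M[R]_n) (B : 'M[R]_(n, m)) :=
  row_full (\sum_(i < n) <<B^T *m (A^T) ^+ i>>)%MS.

Definition sorted_eigenvalues (R : realFieldType) n (M : 'M[R]_n) (s : seq R) :=
  sorted <=%R s /\ char_poly M = \prod_(x <- s) ('X - x%:P).

Definition second_smallest_eigenvalue (R : realFieldType) n (M : 'M[R]_n) (lam : R) :=
  exists s, sorted_eigenvalues M s /\ nth 0 s 1 = lam.

(* Main.v *)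
Require Import Defs.
From HB Require Import structures.
From mathcomp Require Import all_boot all_order all_algebra.
Import Order.TTheory GRing.Theory Num.Theory.
Local Open Scope ring_scope.

(* Put S = P B B^T P, M = c L^2 - L, and let W be the negative definite matrix of
   the Riccati inequality, so that Z = 2 alpha P - W is positive definite.
   Substituting P A + A^T P = 2 S - Z gives Lbar = - (L (x) Z + 2 M (x) S).
   - As c lam2 >= 1, M is positive semidefinite, hence so is M (x) S.
   - The quadratic form of L (x) Z at blocks x_1, ..., x_N is the sum over the
     edges ij of (x_i - x_j)^T Z (x_i - x_j); by connectedness it vanishes only
     when all the blocks are equal.
   So Lbar is negative semidefinite with kernel 1 (x) R^n, of dimension n. For
   a symmetric M, rank M^2 = rank M, and then the algebraic multiplicity of the
   eigenvalue 0 is the dimension of the kernel: in a full-rank factorization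
   M = C D, the matrix D C is invertible and
   X^r char(C D) = X^d char(D C). *)

Set Implicit Arguments.
Unset Strict Implicit.
Unset Printing Implicit Defensive.

(** * Kronecker products and row-major vectorization *)

Lemma kidx_bij m1 m2 :
  bijective (fun k : 'I_(m1 * m2) => (kidx1 k, kidx2 k)).
Proof.
apply: inj_card_bij => [k l [eq_div eq_mod]|]; last by rewrite card_prod !card_ord.
by apply: val_inj; rewrite /= (divn_eq k m2) (divn_eq l m2) eq_div eq_mod.
Qed.

Lemma sum_kidx (V : nmodType) m1 m2 (F : 'I_m1 -> 'I_m2 -> V) :
  \sum_(k < m1 * m2) F (kidx1 k) (kidx2 k) = \sum_i \sum_j F i j.
Proof.
rewrite pair_bigA [RHS](reindex _ (onW_bij _ (kidx_bij m1 m2))).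
by apply: eq_bigr.
Qed.

Section KroneckerAlgebra.
Variable R : comPzRingType.

Lemma kron_mul m1 n1 p1 m2 n2 p2 (A : 'M[R]_(m1, n1)) (B : 'M[R]_(m2, n2))
    (C : 'M[R]_(n1, p1)) (D : 'M[R]_(n2, p2)) :
  kron A B *m kron C D = kron (A *m C) (B *m D).
Proof.
apply/matrixP => i j; rewrite !mxE.
under eq_bigr do rewrite !mxE.
rewrite (sum_kidx (fun k l => A (kidx1 i) k * B (kidx2 i) l *
  (C k (kidx1 j) * D l (kidx2 j)))) big_distrl.
apply: eq_bigr => k _; rewrite big_distrr; apply: eq_bigr => l _ /=.
by rewrite mulrACA.
Qed.

Lemma kron_tr m1 n1 m2 n2 (A : 'M[R]_(m1, n1)) (B : 'M[R]_(m2, n2)) :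
  (kron A B)^T = kron A^T B^T.
Proof. by apply/matrixP => i j; rewrite !mxE. Qed.

Lemma kronDl m1 n1 m2 n2 (A A' : 'M[R]_(m1, n1)) (B : 'M[R]_(m2, n2)) :
  kron (A + A') B = kron A B + kron A' B.
Proof. by apply/matrixP => i j; rewrite !mxE mulrDl. Qed.

Lemma kronDr m1 n1 m2 n2 (A : 'M[R]_(m1, n1)) (B B' : 'M[R]_(m2, n2)) :
  kron A (B + B') = kron A B + kron A B'.
Proof. by apply/matrixP => i j; rewrite !mxE mulrDr. Qed.

Lemma kronZl m1 n1 m2 n2 a (A : 'M[R]_(m1, n1)) (B : 'M[R]_(m2, n2)) :
  kron (a *: A) B = a *: kron A B.
Proof. by apply/matrixP => i j; rewrite !mxE mulrA. Qed.

Lemma kronZr m1 n1 m2 n2 a (A : 'M[R]_(m1, n1)) (B : 'M[R]_(m2, n2)) :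
  kron A (a *: B) = a *: kron A B.
Proof. by apply/matrixP => i j; rewrite !mxE mulrCA. Qed.

Lemma kron0l m1 n1 m2 n2 (B : 'M[R]_(m2, n2)) :
  kron (0 : 'M[R]_(m1, n1)) B = 0.
Proof. by apply/matrixP => i j; rewrite !mxE mul0r. Qed.

Lemma kron11 m1 m2 : kron (1%:M : 'M[R]_m1) (1%:M : 'M[R]_m2) = 1%:M.
Proof.
apply/matrixP => i j; rewrite !mxE -natrM mulnb; congr (_ %:R).
by rewrite -xpair_eqE (bij_eq (kidx_bij m1 m2)).
Qed.

(* Row-major vectorization, so that [kron A B] acts on [kvec X] as
   [X |-> A X B^T]. *)
Definition kvec m1 m2 (X : 'M[R]_(m1, m2)) : 'cV[R]_(m1 * m2) :=
  \col_k X (kidx1 k) (kidx2 k).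

Lemma kvec_surj m1 m2 (v : 'cV[R]_(m1 * m2)) : exists X, v = kvec X.
Proof.
have [g gK _] := kidx_bij m1 m2; exists (\matrix_(i, j) v (g (i, j)) 0).
by apply/matrixP => i j; rewrite !mxE gK ord1.
Qed.

Lemma kron_const1 m1 m2 (s : 'cV[R]_m2) :
  kron (const_mx 1 : 'cV[R]_m1) s = kvec (\matrix_(i, j) s j 0).
Proof. by apply/matrixP => i j; rewrite !mxE mul1r (ord1 (kidx2 j)). Qed.

(** Row [i] of [X] is the [i]-th block of [kvec X]; every Kronecker form below thus reduces to
    bilinear forms on pairs of blocks. *)
Lemma kron_form m1 m2 (G : 'M[R]_m1) (Z : 'M[R]_m2) (X : 'M[R]_(m1, m2)) :
  ((kvec X)^T *m kron G Z *m kvec X) 0 0 =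
  \sum_i \sum_j G i j * (row i X *m Z *m (row j X)^T) 0 0.
Proof.
rewrite mxE.
pose F j l := (\sum_i \sum_k X i k * (G i j * Z k l)) * X j l.
transitivity (\sum_j \sum_l F j l).
  rewrite -sum_kidx; apply: eq_bigr => j _; rewrite !mxE /F; congr (_ * _).
  rewrite -(sum_kidx (fun i k => X i k * (G i _ * Z k _))).
  by apply: eq_bigr => i _; rewrite !mxE.
rewrite exchange_big /= [RHS]exchange_big /= exchange_big /=.
apply: eq_bigr => j _; rewrite /F.
under eq_bigr do rewrite big_distrl.
rewrite exchange_big /=; apply: eq_bigr => i _.
rewrite mxE big_distrr; apply: eq_bigr => l _ /=.
rewrite !mxE mulrA; congr (_ * _); rewrite big_distrr; apply: eq_bigr => k _.
by rewrite !mxE mulrCA.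
Qed.

End KroneckerAlgebra.

(** * Multiplicity of the eigenvalue 0 through full-rank factorizations *)

Section FullRank.
Variable F : fieldType.

(** The determinant of [U] is computed twice: its lower left block is cleared by a unimodular factor
    on the right, then by a factor of determinant ['X^r] on the left. *)
Lemma char_poly_mulmxC m r (C : 'M[F]_(m, r)) (D : 'M[F]_(r, m)) :
  'X^r * char_poly (C *m D) = 'X^m * char_poly (D *m C).
Proof.
pose CX := map_mx polyC C; pose DX := map_mx polyC D.
pose U := block_mx ('X%:M) CX DX (1%:M : 'M_r).
have h1 : U *m block_mx (1%:M : 'M_m) 0 (- DX) 1%:M
    = block_mx (char_poly_mx (C *m D)) CX 0 1%:M.
  rewrite mulmx_block !mulmx1 !mulmx0 !mul1mx addrN add0r add0r.
  by rewrite mulmxN /char_poly_mx map_mxM.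
have h2 : block_mx (1%:M : 'M_m) 0 (- DX) ('X%:M) *m U
    = block_mx ('X%:M) CX 0 (char_poly_mx (D *m C)).
  rewrite mulmx_block !mul1mx !mul0mx !addr0 mulmx1 !mulNmx.
  by rewrite scalar_mxC addNr addrC /char_poly_mx map_mxM.
move/(congr1 determinant): h1; move/(congr1 determinant): h2.
rewrite !det_mulmx !det_lblock !det_ublock !det1 !det_scalar !mul1r !mulr1.
by rewrite /char_poly => <- ->.
Qed.

Lemma mup0_char_poly d (M : 'M[F]_d) :
  \rank (M *m M) = \rank M -> mup 0 (char_poly M) = (d - \rank M)%N.
Proof.
move=> rkM2; set r := \rank M.
have eqX : 'X^r * char_poly M = 'X^d * char_poly (row_base M *m col_base M).
  by rewrite -char_poly_mulmxC mulmx_base.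
(* With [M = C D], [M *m M] is [C (D C) D], so its rank [r] bounds that of [D C] from below. *)
have DCfree : row_free (row_base M *m col_base M).
  rewrite -row_leq_rank -[leqLHS]rkM2.
  have -> : M *m M = col_base M *m (row_base M *m col_base M) *m row_base M.
    by rewrite -[LHS]/(mulmx M M) -{1 2}(mulmx_base M) !mulmxA.
  by apply: leq_trans (mxrankM_maxl _ _) _; apply: mxrankM_maxr.
have nroot0 : ~~ root (char_poly (row_base M *m col_base M)) 0.
  rewrite -eigenvalue_root_char; apply/eigenvalueP => -[v].
  rewrite scale0r => /eqP v_ker /negP; apply.
  by rewrite -(mulmx_free_eq0 _ DCfree).
have X0 k : ('X^k : {poly F}) != 0 by rewrite monic_neq0 ?monicXn.
have mupX k : mup (0 : F) 'X^k = k.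
  by have := mup_XsubCX k (0 : F) 0; rewrite subr0 eqxx.
have cp0 n (B : 'M[F]_n) : char_poly B != 0 by rewrite monic_neq0 ?char_poly_monic.
have := congr1 (mup 0) eqX; rewrite !mupM // !mupX (mupNroot nroot0) addn0.
by move=> rank_mup; rewrite -[X in (X - _)%N]rank_mup addKn.
Qed.

End FullRank.

(** * Spectral facts on symmetric matrices *)

Section Symmetric.
Variable R : rcfType.

Lemma mulmx_tr_diag m n (X : 'M[R]_(m, n)) i :
  (X *m X^T) i i = \sum_j X i j ^+ 2.
Proof. by rewrite mxE; apply: eq_bigr => j _; rewrite mxE expr2. Qed.

Lemma mulmx_tr_diag_ge0 m n (X : 'M[R]_(m, n)) i : 0 <= (X *m X^T) i i.
Proof. by rewrite mulmx_tr_diag sumr_ge0 // => j _; rewrite sqr_ge0. Qed.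

Lemma mulmx_tr_eq0 m n (X : 'M[R]_(m, n)) : (X *m X^T == 0) = (X == 0).
Proof.
apply/eqP/eqP => [XX0|->]; last by rewrite mul0mx.
apply/matrixP => i j; rewrite mxE; apply/eqP.
have := mulmx_tr_diag X i; rewrite XX0 mxE => /esym/eqP.
rewrite psumr_eq0 => [/allP/(_ j)|k _]; last by rewrite sqr_ge0.
by rewrite mem_index_enum sqrf_eq0 => /(_ isT).
Qed.

(** The row space and the kernel meet trivially: if [v = w M] and [v M = 0], then
    [v v^T = w M M w^T = 0]. *)
Lemma mxrank_sqr_sym n (M : 'M[R]_n) : M^T = M -> \rank (M *m M) = \rank M.
Proof.
move=> M_sym; have := mxrank_mul_ker M M.
suff -> : (M :&: kermx M)%MS = 0 by rewrite mxrank0 addn0.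
apply/eqP; rewrite -submx0; apply/rV_subP => v; rewrite sub_capmx.
case/andP=> /submxP[w ->] /sub_kermxP wMM0; rewrite submx0 -mulmx_tr_eq0.
by rewrite trmx_mul M_sym mulmxA wMM0 mul0mx.
Qed.

Lemma horner_mx_sym n (M : 'M[R]_n.+1) p :
  M^T = M -> (horner_mx M p)^T = horner_mx M p.
Proof.
move=> M_sym; elim/poly_ind: p => [|p c IHp]; first by rewrite rmorph0 trmx0.
rewrite rmorphD rmorphM /= horner_mx_X horner_mx_C raddfD /= tr_scalar_mx.
congr (_ + _); rewrite -[LHS]/(_ *m M)^T trmx_mul IHp M_sym.
by have := comm_horner_mx2 M p 'X; rewrite horner_mx_X => ->.
Qed.

(** The exponent descends by one: [M ^+ k.+1] is symmetric, and its square is a multiple of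
    [M ^+ k.+2], hence zero. *)
Lemma sym_nilp_eq0 n (M : 'M[R]_n.+1) k : M^T = M -> M ^+ k = 0 -> M = 0.
Proof.
move=> M_sym; elim: k => [|[//|k] IHk] M0.
  by rewrite -[M]mulr1 -(expr0 M) M0 mulr0.
apply: IHk; apply/eqP; rewrite -mulmx_tr_eq0.
have -> : (M ^+ k.+1)^T = M ^+ k.+1.
  by rewrite -[M in M ^+ _]horner_mx_X -rmorphXn horner_mx_sym.
rewrite -[X in X == 0]/(M ^+ k.+1 * M ^+ k.+1) -exprD addnS -addSn exprD.
by rewrite M0 mul0r.
Qed.

(* The squarefree part q of the characteristic polynomial annihilates M, because
   q(M) is symmetric and nilpotent. *)
Lemma sym_diagonalizable n (M : 'M[R]_n) (s : seq R) :
  M^T = M -> char_poly M = \prod_(x <- s) ('X - x%:P) ->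
  exists2 U, U \in unitmx & exists d, U *m M = diag_mx d *m U.
Proof.
case: n M => [|n] M M_sym eq_char.
  by exists 1%:M; rewrite ?unitmx1 //; exists 0; apply/matrixP => -[].
pose q := \prod_(x <- undup s) ('X - x%:P).
have /dvdpP[r eq_qn] : char_poly M %| q ^+ size s.
  rewrite {}eq_char; have : {subset s <= undup s} by move=> x; rewrite mem_undup.
  elim: {-2}s => [|x t IHt] st_s; first by rewrite big_nil dvd1p.
  rewrite big_cons exprS dvdp_mul ?IHt => // [|y ty].
    by rewrite dvdp_XsubCl root_prod_XsubC st_s ?mem_head.
  by rewrite st_s // inE ty orbT.
have [U Uunit /similar_diagPex[d /(similarP Uunit) eqUM]] : diagonalizable M.
  apply/diagonalizableP; exists (undup s); rewrite ?undup_uniq //.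
  apply: mxminpoly_min; apply: (@sym_nilp_eq0 _ _ (size s)).
    exact: horner_mx_sym.
  by rewrite -rmorphXn eq_qn rmorphM /= Cayley_Hamilton mulr0.
by exists U => //; exists d.
Qed.

(* The Gram matrix G = U U^T commutes with diag d, hence with its square root s,
   so the form at x = (y U)^T is y s^2 G y^T = y s G s y^T = |y s U|^2. *)
Lemma psd_of_eigenrows n (M U : 'M[R]_n) (d : 'rV[R]_n) (x : 'cV[R]_n) :
    M^T = M -> U \in unitmx -> U *m M = diag_mx d *m U ->
    (forall i, 0 <= d 0 i) ->
  0 <= (x^T *m M *m x) 0 0.
Proof.
move=> M_sym Uunit eqUM d_ge0.
pose s := diag_mx (map_mx Num.sqrt d); pose G := U *m U^T.
have ss : s *m s = diag_mx d.
  rewrite mulmx_diag; congr diag_mx; apply/rowP => i.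
  by rewrite !mxE -expr2 sqr_sqrtr.
have dG : diag_mx d *m G = G *m diag_mx d.
  transitivity (U *m M *m U^T); first by rewrite eqUM mulmxA.
  by rewrite -[diag_mx d]tr_diag_mx /G -[RHS]mulmxA -trmx_mul -eqUM trmx_mul M_sym !mulmxA.
(* Entrywise, [dG] says that [G i j] vanishes or [d 0 i = d 0 j]; in the second case the square
   roots agree too. *)
have sG : s *m G = G *m s.
  apply/matrixP => i j; rewrite mul_diag_mx mul_mx_diag !mxE.
  have /matrixP/(_ i j) := dG; rewrite mul_diag_mx mul_mx_diag ![in X in X -> _]mxE.
  set g := G i j; rewrite mulrC => /eqP; rewrite -subr_eq0 -mulrBr mulf_eq0 subr_eq0.
  by case/orP=> /eqP->; rewrite ?mul0r ?mulr0 1?mulrC.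
have [y ->] : exists y : 'rV_n, x = (y *m U)^T.
  by exists (x^T *m invmx U); rewrite mulmxKV // trmxK.
rewrite trmxK trmx_mul -(mulmxA y) eqUM -ss.
have -> : y *m (s *m s *m U) *m (U^T *m y^T) = (y *m s *m U) *m (y *m s *m U)^T.
  rewrite !trmx_mul tr_diag_mx -/s.
  transitivity (y *m s *m (s *m G) *m y^T); first by rewrite /G !mulmxA.
  by rewrite sG /G !mulmxA.
exact: mulmx_tr_diag_ge0.
Qed.

End Symmetric.

(** Past the end of the spectrum [nth] returns its default [0], which [0 < lam] excludes. *)
Lemma second_smallest_gt1 (R : realFieldType) n (M : 'M[R]_n) lam :
  second_smallest_eigenvalue M lam -> 0 < lam -> (1 < n)%N.
Proof.
case=> s [[_ eq_char] <-] s1_gt0; have : (1 < size s)%N.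
  by rewrite ltnNge; apply/negP => /(nth_default 0) s1; rewrite s1 ltxx in s1_gt0.
by have := size_char_poly M; rewrite eq_char size_prod_XsubC => -[->].
Qed.

(** * Quadratic forms and spectral gap of the Laplacian *)

Section Laplacian.
Variables (R : rcfType) (N : nat) (e : rel 'I_N).
Hypotheses (e_sym : symmetric e) (e_conn : connected_graph e).
Local Notation L := (laplacian R e).

Lemma laplacian_sym : L^T = L.
Proof.
apply/matrixP => i j; rewrite !mxE (e_sym j) (eq_sym j).
by case: eqP => [->|].
Qed.

(** Row [i] contributes [g i i - g i j] for each neighbour [j]. Doubling the sum and swapping the
    indices in one copy symmetrizes this; each edge is met in both orientations. *)
Lemma sum_laplacian (g : 'I_N -> 'I_N -> R) :
  (\sum_i \sum_j L i j * g i j) *+ 2 =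
  \sum_i \sum_(j | e i j) (g i i + g j j - g i j - g j i).
Proof.
have Lg : \sum_i \sum_j L i j * g i j = \sum_i \sum_(j | e i j) (g i i - g i j).
  apply: eq_bigr => i _; under eq_bigr do rewrite !mxE mulrBl.
  rewrite big_split /= [X in X + _](bigD1 i) //= eqxx.
  rewrite [X in _ + X + _]big1 => [|j /negPf]; last first.
    by rewrite eq_sym => ->; rewrite mul0r.
  rewrite addr0 big_distrl -big_split [RHS]big_mkcond /=.
  by apply: eq_bigr => j _; rewrite !mxE; case: ifP; rewrite ?mul1r ?mul0r ?subr0.
rewrite mulr2n Lg; under [X in _ + X]eq_bigr do rewrite big_mkcond.
rewrite exchange_big -big_split; apply: eq_bigr => i _ /=.
rewrite [X in X + _]big_mkcond [RHS]big_mkcond -big_split /=.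
apply: eq_bigr => j _; rewrite e_sym; case: ifP => _; last by rewrite addr0.
by rewrite addrACA addrA.
Qed.

(** For a bilinear [g], the edge term of [sum_laplacian] is the expansion of the form at a
    difference of blocks. *)
Lemma kron_laplacian_form n (Z : 'M[R]_n) (X : 'M[R]_(N, n)) :
  ((kvec X)^T *m kron L Z *m kvec X) 0 0 *+ 2 =
  \sum_i \sum_(j | e i j)
    ((row i X - row j X) *m Z *m (row i X - row j X)^T) 0 0.
Proof.
rewrite kron_form (sum_laplacian (fun i j => (row i X *m Z *m (row j X)^T) 0 0)).
apply: eq_bigr => i _; apply: eq_bigr => j _.
have subE (A B : 'M[R]_1) : (A - B) 0 0 = A 0 0 - B 0 0 by rewrite !mxE.
rewrite linearB /= mulmxBr !mulmxBl !subE opprB addrACA.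
by rewrite [- _ - _]addrC addrA.
Qed.

Lemma laplacian_const1 : L *m (const_mx 1 : 'cV_N) = 0.
Proof.
apply/matrixP => i j; rewrite [RHS]mxE mxE.
under eq_bigr do rewrite !mxE mulr1.
rewrite big_split /= (bigD1 i) //= eqxx [X in _ + X + _]big1.
  by rewrite addr0 -big_split big1 //= => k _; rewrite !mxE subrr.
by move=> k /negPf; rewrite eq_sym => ->.
Qed.

Section PosDef.
Variables (n : nat) (Z : 'M[R]_n).
Hypothesis Z_pos : posdef Z.

Lemma posdef_row_ge0 (u : 'rV[R]_n) : 0 <= (u *m Z *m u^T) 0 0 ?= iff (u == 0).
Proof.
have [->|u0] := eqVneq u 0; first by rewrite !mul0mx mxE; exact/leif_refl.
have := Z_pos.2 u^T; rewrite trmxK trmx_eq0 => /(_ u0) form_gt0.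
by split; rewrite ?ltW // lt_eqF.
Qed.

Lemma kron_laplacian_ge0 (v : 'cV[R]_(N * n)) :
  0 <= (v^T *m kron L Z *m v) 0 0.
Proof.
have [X ->] := kvec_surj v; rewrite -(pmulrn_lge0 _ (ltn0Sn 1)).
rewrite kron_laplacian_form; do 2![apply: sumr_ge0 => ? _].
exact: posdef_row_ge0.
Qed.

Lemma kron_laplacian_eq0 (v : 'cV[R]_(N * n)) :
    (v^T *m kron L Z *m v) 0 0 = 0 ->
  exists s : 'cV_n, v = kron (const_mx 1 : 'cV[R]_N) s.
Proof.
have [X ->] := kvec_surj v; move=> form0.
have := kron_laplacian_form Z X; rewrite {}form0 mul0rn => /esym/eqP.
have term_ge0 i j := posdef_row_ge0 (row i X - row j X).
rewrite psumr_eq0 => [/allP rows0|i _]; last first.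
  by apply: sumr_ge0 => j _; apply: term_ge0.
have edge_eq i j : e i j -> row i X = row j X.
  move=> eij; have := rows0 i; rewrite mem_index_enum => /(_ isT) /=.
  rewrite psumr_eq0 => [/allP/(_ j)|k _]; last exact: term_ge0.
  rewrite mem_index_enum => /(_ isT); rewrite eij /= eq_sym term_ge0.
  by rewrite subr_eq0 => /eqP.
have row_eq i j : row i X = row j X.
  have /connectP[p e_p ->] := e_conn i j.
  by elim: p i e_p => //= k p IHp i /andP[/edge_eq -> /IHp].
(* Any row serves as the common block. Without nodes the vector is empty and [0] will do. *)
have [i0 _|N0] := pickP 'I_N.
  exists (row i0 X)^T; rewrite kron_const1; congr kvec; apply/matrixP => i j.
  by have /rowP/(_ j) := row_eq i i0; rewrite !mxE.
by exists 0; apply/matrixP => k; have := N0 (kidx1 k).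
Qed.

End PosDef.

(* [L] is diagonalizable and its eigenvalues other than [0] are at least [lam2],
   so that [c r^2 - r >= 0] on its spectrum. *)
Lemma laplacian_gap (lam2 c : R) (x : 'cV[R]_N) :
    second_smallest_eigenvalue L lam2 -> 0 < lam2 -> 1 / lam2 <= c ->
  0 <= (x^T *m (c *: (L *m L) - L) *m x) 0 0.
Proof.
move=> lam2P lam2_gt0 c_ge; have [s [[s_sorted eq_char] s1]] := lam2P.
have [U Uunit [d eqUL]] := sym_diagonalizable laplacian_sym eq_char.
have root_s r : (r \in s) = eigenvalue L r.
  by rewrite eigenvalue_root_char eq_char root_prod_XsubC.
have s_N : size s = N.
  by apply: succn_inj; rewrite -(size_char_poly L) eq_char size_prod_XsubC.
have s_size : (1 < size s)%N.
  by rewrite s_N (second_smallest_gt1 lam2P lam2_gt0).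
have nth_ge k : (0 < k < size s)%N -> lam2 <= nth 0 s k.
  case/andP=> k_gt0 k_lt; rewrite -s1.
  by apply: (sorted_leq_nth le_trans le_refl) => //; rewrite ?inE.
have s_0 : 0 \in s.
  rewrite root_s; apply/eigenvalueP; exists (const_mx 1).
    rewrite scale0r -[LHS]trmxK trmx_mul laplacian_sym trmx_const.
    by rewrite laplacian_const1 trmx0.
  apply/eqP => /rowP/(_ (cast_ord s_N (Ordinal (ltnW s_size)))).
  by rewrite !mxE => /eqP; rewrite oner_eq0.
(* Entries at a positive index are at least [lam2 > 0], so [0] sits at index 0 and is the only value
   whose first index is 0. *)
have gap r : r \in s -> r = 0 \/ lam2 <= r.
  move=> rs; have := nth_ge (index r s); rewrite nth_index // index_mem rs andbT.
  case: posnP => [r_0 _|_ /(_ isT)]; last by right.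
  have := nth_ge (index 0 s); rewrite nth_index // index_mem s_0 andbT.
  case: posnP => [z_0 _|_ /(_ isT)]; last by rewrite leNgt lam2_gt0.
  by left; rewrite -(nth_index 0 rs) r_0 -z_0 nth_index.
have d_s i : d 0 i \in s.
  rewrite root_s; apply/eigenvalueP; exists (row i U).
    by rewrite -row_mul eqUL row_mul row_diag_mx -scalemxAl -rowE.
  apply/eqP => row0; move: Uunit; rewrite -row_free_unit => /row_free_inj.
  move/(_ 1 (delta_mx 0 i) 0); rewrite mul0mx -rowE row0 => /(_ erefl)/rowP/(_ i).
  by rewrite !mxE !eqxx => /eqP; rewrite oner_eq0.
(* The rows of [U] are also eigenvectors of [c *: (L *m L) - L], with these eigenvalues. *)
pose d' : 'rV[R]_N := \row_i (c * d 0 i ^+ 2 - d 0 i).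
apply: (@psd_of_eigenrows _ _ _ U d') => // [||i].
- by rewrite linearB linearZ /= trmx_mul laplacian_sym.
- rewrite mulmxBr -scalemxAr mulmxA eqUL -mulmxA eqUL mulmxA mulmx_diag.
  rewrite scalemxAl -mulmxBl; congr (_ *m U); apply/matrixP => i j.
  by rewrite !mxE expr2; case: eqP => _; rewrite ?mulr1n ?mulr0n ?mulr0 ?subr0.
rewrite mxE; case: (gap _ (d_s i)) => [->|lam2_le].
  by rewrite expr0n mulr0 subr0.
have d_gt0 := lt_le_trans lam2_gt0 lam2_le.
(* For an eigenvalue [r >= lam2], [1 <= c * lam2 <= c * r] gives [r <= c * r ^+ 2]. *)
rewrite subr_ge0 expr2 mulrA ler_peMl ?(ltW d_gt0) //.
have c_ge0 : 0 <= c by apply: le_trans c_ge; rewrite divr_ge0 ?ltW.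
by move: c_ge; rewrite ler_pdivrMr // => /le_trans; apply; rewrite ler_wpM2l.
Qed.

End Laplacian.

(** The factor [C *m C^T] splits the form into a sum of forms of [M], one at each column of
    [X *m C]. *)
Lemma kron_psd_ge0 (R : rcfType) N n m (M : 'M[R]_N) (C : 'M[R]_(n, m))
    (v : 'cV[R]_(N * n)) :
    (forall x : 'cV[R]_N, 0 <= (x^T *m M *m x) 0 0) ->
  0 <= (v^T *m kron M (C *m C^T) *m v) 0 0.
Proof.
move=> M_ge0; have [X ->] := kvec_surj v; rewrite kron_form.
pose Y := X *m C.
suff -> : \sum_i \sum_j M i j * (row i X *m (C *m C^T) *m (row j X)^T) 0 0
    = \sum_l ((col l Y)^T *m M *m col l Y) 0 0 by exact: sumr_ge0.
transitivity (\sum_i \sum_j \sum_l Y i l * M i j * Y j l).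
  apply: eq_bigr => i _; apply: eq_bigr => j _.
  have -> : row i X *m (C *m C^T) *m (row j X)^T = row i Y *m (row j Y)^T.
    by rewrite !row_mul trmx_mul !mulmxA.
  rewrite mxE big_distrr; apply: eq_bigr => l _ /=.
  by rewrite !mxE mulrA [M i j * _]mulrC.
under eq_bigr do rewrite exchange_big /=.
rewrite exchange_big; apply: eq_bigr => l _ /=.
rewrite exchange_big mxE; apply: eq_bigr => j _ /=.
by rewrite [(_ *m M) 0 j]mxE big_distrl; apply: eq_bigr => i _ /=; rewrite !mxE.
Qed.

Theorem theorem1 (R : rcfType) (n m N : nat)
  (A : 'M[R]_n) (B : 'M[R]_(n, m)) (alpha : R) (P : 'M[R]_n)
  (e : rel 'I_N) (lam2 c : R) :
  controllable A B ->
  0 < alpha ->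
  posdef P ->
  negdef (P *m A + A^T *m P - 2%:R *: (P *m B *m B^T *m P) + (2%:R * alpha) *: P) ->
  simple_graph e -> connected_graph e ->
  second_smallest_eigenvalue (laplacian R e) lam2 -> 0 < lam2 ->
  1 / lam2 <= c ->
  let L := laplacian R e in
  let F := - (B^T *m P) in
  let Lhat := kron L P in
  let Abar := kron (1%:M : 'M[R]_N) A in
  let Bbar := c *: kron L (B *m F) in
  let Ac := Abar + Bbar in
  let Lbar := Lhat *m Ac + Ac^T *m Lhat in
  [/\ mup 0 (char_poly Lbar) = n,
      (forall x : R, root (char_poly Lbar) x -> x != 0 -> x < 0) &
      (forall v : 'cV[R]_(N * n), Lbar *m v = 0 ->
         exists s : 'cV[R]_n, v = kron (const_mx 1 : 'cV[R]_N) s)].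
Proof.
move=> _ alpha_gt0 P_pos W_neg [e_sym _] e_conn lam2P lam2_gt0 c_ge.
move=> L F Lhat Abar Bbar Ac Lbar; have P_sym := P_pos.1.
have L_sym : L^T = L := laplacian_sym R e_sym.
pose C := P *m B; pose W := P *m A + A^T *m P
  - 2%:R *: (P *m B *m B^T *m P) + (2%:R * alpha) *: P.
pose Z := (2%:R * alpha) *: P - W.
have Z_pos : posdef Z.
  split=> [|x x0]; first by rewrite linearB linearZ /= P_sym W_neg.1.
  rewrite mulmxBr mulmxBl -scalemxAr -scalemxAl 2!mxE [X in _ + X]mxE.
  by rewrite addr_gt0 ?oppr_gt0 ?W_neg.2 // !mulr_gt0 // ?P_pos.2.
have Lbar_sym : Lbar^T = Lbar.
  by rewrite linearD /= !trmx_mul trmxK !kron_tr L_sym P_sym addrC.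
pose M := c *: (L *m L) - L.
have LbarE : Lbar = - (kron L Z + 2%:R *: kron M (C *m C^T)).
  have CCE : C *m C^T = P *m B *m B^T *m P.
    by rewrite /C trmx_mul P_sym !mulmxA.
  have PAE : P *m A + A^T *m P = 2%:R *: (C *m C^T) - Z.
    by rewrite /Z /W -CCE opprB addrK [RHS]addrC subrK.
  (* The coupling term and its transpose each give [- c] times [kron (L *m L) (C *m C^T)], whence
     the factor 2. *)
  have Lbar2 : Lbar = kron L (P *m A + A^T *m P)
      - (2%:R * c) *: kron (L *m L) (C *m C^T).
    rewrite /Lbar /Lhat /Ac mulmxDr linearD /= mulmxDl /Abar /Bbar.
    rewrite -scalemxAr linearZ /= -scalemxAl !kron_tr !kron_mul trmx1 mulmx1 mul1mx L_sym.
    rewrite kronDr addrACA; congr (_ + _).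
    have -> : P *m (B *m F) = - 1 *: (C *m C^T).
      by rewrite CCE /F mulmxN mulmxN scaleN1r !mulmxA.
    have -> : (B *m F)^T *m P = - 1 *: (C *m C^T).
      rewrite CCE /F trmx_mul linearN /= trmx_mul trmxK P_sym.
      by rewrite !mulNmx scaleN1r.
    rewrite kronZr !scalerA -scalerDl -scaleNr; congr (_ *: _).
    by rewrite mulrN1 mulrDl mul1r opprD.
  rewrite Lbar2 PAE (kronDr L (2%:R *: _)) (kronDl (c *: _) (- L)).
  rewrite -[- L]scaleN1r -[- Z]scaleN1r !kronZl !kronZr.
  rewrite scalerDr !scalerA !scaleN1r mulrN1 !scaleNr !opprD opprK.
  by rewrite addrAC addrC [X in _ = _ + X]addrC addrA.
have one_ker : Lbar *m kron (const_mx 1 : 'cV_N) (1%:M : 'M_n) = 0.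
  rewrite LbarE mulNmx mulmxDl -scalemxAl !kron_mul laplacian_const1 kron0l.
  rewrite mulmxBl -scalemxAl -mulmxA laplacian_const1 mulmx0 scaler0 subr0.
  by rewrite kron0l scaler0 addr0 oppr0.
have form_le (v : 'cV_(N * n)) :
    (v^T *m Lbar *m v) 0 0 <= - (v^T *m kron L Z *m v) 0 0.
  rewrite LbarE mulmxN mulNmx mulmxDr mulmxDl -scalemxAr -scalemxAl.
  rewrite mxE lerN2 [leRHS]mxE lerDl mxE mulr_ge0 ?kron_psd_ge0 // => x.
  exact: (@laplacian_gap _ _ _ e_sym _ _ x lam2P).
have ker_const v : Lbar *m v = 0 ->
    exists s : 'cV_n, v = kron (const_mx 1 : 'cV_N) s.
  (* At a null vector [form_le] bounds the nonnegative form of [kron L Z] above by 0. *)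
  move=> v_ker; apply: (kron_laplacian_eq0 e_sym e_conn Z_pos).
  apply/eqP; rewrite eq_le kron_laplacian_ge0 // andbT -oppr_ge0.
  by apply: le_trans (form_le v); rewrite -mulmxA v_ker mulmx0 mxE.
split=> // [|x].
  rewrite (mup0_char_poly (mxrank_sqr_sym Lbar_sym)) -mxrank_ker.
  (* [kermx] consists of row vectors, so it is compared with the row space of [K]; the symmetry of
     [Lbar] carries [ker_const] and [one_ker] over to rows. *)
  pose K := kron (const_mx 1 : 'rV[R]_N) (1%:M : 'M_n).
  have K_tr : K^T = kron (const_mx 1 : 'cV_N) (1%:M : 'M_n).
    by rewrite kron_tr trmx_const trmx1.
  have K_free : row_free K.
    (* A positive [lam2] provides a node; extracting its block is a right inverse of [K]. *)
    pose i0 : 'I_N := Ordinal (ltnW (second_smallest_gt1 lam2P lam2_gt0)).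
    apply/row_freeP; exists (kron (delta_mx i0 0 : 'cV_N) 1%:M).
    rewrite kron_mul mulmx1 -kron11; congr kron; apply/matrixP => i j.
    rewrite !ord1 !mxE (bigD1 i0) //= big1 ?addr0 => [|k /negPf k_i0].
      by rewrite !mxE !eqxx mulr1.
    by rewrite !mxE k_i0 mulr0.
  rewrite -[RHS]mul1n -[RHS](eqP K_free); apply: eqmx_rank; apply/andP; split.
    apply/rV_subP => u /sub_kermxP uLbar0; have [] := ker_const u^T.
      by rewrite -[LHS]trmxK trmx_mul trmxK Lbar_sym uLbar0 trmx0.
    move=> s /(congr1 trmx); rewrite trmxK => ->.
    rewrite kron_tr trmx_const; apply/submxP; exists (kron (1%:M : 'M_1) s^T).
    have := kron_mul (1%:M : 'M[R]_1) s^T (const_mx 1 : 'rV_N) 1%:M.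
    by rewrite mul1mx mulmx1 => kronE; exact: esym kronE.
  apply/sub_kermxP; rewrite -[LHS]trmxK trmx_mul Lbar_sym K_tr.
  by rewrite one_ker trmx0.
(* Rayleigh quotient: [x] times the squared norm of the eigenvector [u] is the form of [Lbar] at
   [u^T], which is at most 0. *)
rewrite -eigenvalue_root_char => /eigenvalueP[u uLbar u0] x0.
have u_gt0 : 0 < (u *m u^T) 0 0.
  rewrite lt_neqAle mulmx_tr_diag_ge0 andbT eq_sym; apply: contra u0 => /eqP uu0.
  rewrite -mulmx_tr_eq0; apply/eqP/matrixP => i j.
  by rewrite !ord1 uu0 mxE.
rewrite lt_neqAle x0 /= -(pmulr_lle0 _ u_gt0).
have -> : x * (u *m u^T) 0 0 = (u^T^T *m Lbar *m u^T) 0 0.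
  by rewrite trmxK uLbar -scalemxAl [RHS]mxE.
by apply: le_trans (form_le _) _; rewrite oppr_le0 kron_laplacian_ge0.
Qed.
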